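(* Let $(T_t)_{t\ge0}$ be a strongly continuous semigroup of operators on a complex separable infinite dimensional Banach space $X$. Then the following assertions are equivalent: (1) $(T_t)_{t\ge0}$ is diskcyclic; (2) for all $y,z\in X$ and all $\varepsilon>0$, there exist $v\in X$, $t>0$ and $\alpha\in\mathbb{D}$ such that $\|y-v\|<\varepsilon$ and $\|z-\alpha T_tv\|<\varepsilon$; (3) for all $y,z\in X$, all $\varepsilon>0$ and all $l\ge0$, there exist $v\in X$, $t>l$ and $\alpha\in\mathbb{D}$ such that $\|y-v\|<\varepsilon$ and $\|z-\alpha T_tv\|<\varepsilon$.
   Context: An operator is a continuous linear operator, and $\mathbb{D}=\{\alpha\in\mathbb{C}:|\alpha|\le 1\}$. A strongly continuous semigroup of operators ($C_0$-semigroup) on $X$ is a family $(T_t)_{t\ge0}$ of operators on $X$ with $T_0=I$, $T_{t+s}=T_tT_s$ for all $t,s\ge0$, and $\lim_{t\to s}T_tx=T_sx$ for all $x\in X$ and $s\ge0$. It is diskcyclic if there is $x\in X$ such that $\{\alpha T_tx:\alpha\in\mathbb{D},\,t\ge0\}$ is dense in $X$. *)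

(* Defs.v *)
From HB Require Import structures.
From mathcomp Require Import all_boot all_order all_algebra.
From mathcomp Require Import complex.
From mathcomp Require Import all_classical all_reals all_analysis.

Set Implicit Arguments.
Unset Strict Implicit.
Unset Printing Implicit Defensive.

Import Order.TTheory GRing.Theory Num.Theory.
Import numFieldTopology.Exports numFieldNormedType.Exports.

Local Open Scope classical_set_scope.
Local Open Scope ring_scope.
Local Open Scope complex_scope.

Definition separable_space (X : topologicalType) : Prop :=
  exists2 D : set X, countable D & dense D.

Definition finite_dimensional (K : fieldType) (V : lmodType K) : Prop :=
  exists (n : nat) (e : 'I_n -> V),
    forall x : V, exists c : 'I_n -> K, x = \sum_(i < n) c i *: e i.

Definition infinite_dimensional (K : fieldType) (V : lmodType K) : Prop :=
  ~ finite_dimensional V.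

(* The closed unit disk; the order of R[i] compares only numbers with equal
   imaginary parts, and `|alpha| : R[i] is real. *)
Definition unit_disk (R : realType) : set R[i] := [set alpha | `|alpha| <= 1].

(* The semigroup is indexed by t >= 0: the values T t for t < 0 are
   unconstrained and never used, and the limits t --> s are taken within
   [0, +oo[. *)
Record C0_semigroup (R : realType) (X : normedModType R[i])
    (T : R -> {linear X -> X}) : Prop := {
  C0_semigroup_operator : forall t : R, 0 <= t -> continuous (T t) ;
  C0_semigroup0 : forall x : X, T 0 x = x ;
  C0_semigroupD : forall t s : R, 0 <= t -> 0 <= s ->
    forall x : X, T (t + s) x = T t (T s x) ;
  C0_semigroup_cvg : forall (x : X) (s : R), 0 <= s ->
    T t x @[t --> within [set t : R | 0 <= t] (nbhs s)] --> T s x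
}.

Definition disk_orbit (R : realType) (X : normedModType R[i])
    (T : R -> {linear X -> X}) (x : X) : set X :=
  [set y | exists (alpha : R[i]) (t : R),
     [/\ unit_disk alpha, 0 <= t & y = alpha *: T t x]].

Definition diskcyclic (R : realType) (X : normedModType R[i])
    (T : R -> {linear X -> X}) : Prop :=
  exists x : X, dense (disk_orbit T x).

(* Main.v *)
(* If x has a dense disk orbit, then for every L the tail {alpha T_t x : t > L}
   of this orbit is still dense: otherwise some ball would lie in the closure of
   {alpha T_t x : t <= L}, which is covered by small neighbourhoods of finitely
   many disks D e_i; rescaling, every w is within |w|/2 of a combination of the
   e_i with coefficients O(|w|), and iterating this writes w exactly as such a
   combination, with coefficients given by geometrically convergent series. So X
   would be finite dimensional. Now pick v = a T_s x near y with v <> 0; the tail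
   t > s + l yields b T_r x near z / a, so b T_(r-s) v is near z.
   Conversely, for z_n in a countable dense set, the set of all v with some
   alpha T_t v within 1/m of z_n is open and dense, and Baire's theorem gives a
   common point of these sets. *)

Require Import Defs.
From HB Require Import structures.
From mathcomp Require Import all_boot all_order all_algebra.
From mathcomp Require Import complex ring lra.
From mathcomp Require Import all_classical all_reals all_analysis.

Set Implicit Arguments.
Unset Strict Implicit.
Unset Printing Implicit Defensive.

Import Order.TTheory GRing.Theory Num.Theory.
Import numFieldTopology.Exports numFieldNormedType.Exports.

Local Open Scope classical_set_scope.
Local Open Scope ring_scope.
Local Open Scope complex_scope.

(** * Real radii and density in a complex normed space *)

(** Elements of [R[i]] comparable with 0 are real, so radii and norms can be replaced by real
    numbers and estimated in [R]. *)
Lemma gt0_complexP (R : realType) (e : R[i]) :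
  0 < e -> exists2 r : R, 0 < r & e = r%:C.
Proof.
move=> e0; exists (complex.Re e); last by rewrite RRe_real// gtr0_real.
by rewrite -ltcR RRe_real// gtr0_real.
Qed.

Lemma ge0_complexP (R : realType) (e : R[i]) :
  0 <= e -> exists2 r : R, 0 <= r & e = r%:C.
Proof.
move=> e0; exists (complex.Re e); last by rewrite RRe_real// ger0_real.
by rewrite -lecR RRe_real// ger0_real.
Qed.

Lemma normR_complex (R : realType) (r : R) : `|r%:C| = `|r|%:C.
Proof. by rewrite normc_def /= expr0n addr0 sqrtr_sqr. Qed.

Lemma norm_complex_le (R : realType) (z : R[i]) :
  `|z| <= (`|complex.Re z| + `|complex.Im z|)%:C.
Proof.
rewrite {1}(complexE z) rmorphD/=.
rewrite (le_trans (ler_normD _ _))// lerD ?normR_complex// normrM normR_complex.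
by rewrite normc_def/= expr0n add0r expr1n sqrtr1 mul1r.
Qed.

Lemma open_norm_ball (R : realType) (X : normedModType R[i]) (O : set X) (x : X) :
  open O -> O x -> exists2 r : R, 0 < r & forall y, `|x - y| < r%:C -> O y.
Proof.
move=> Oo Ox; have /nbhs_normP[e /= /gt0_complexP[r r0 ->]] : nbhs x O.
  by apply: open_nbhs_nbhs.
by move=> ballO; exists r => // y xy; apply: ballO.
Qed.

Lemma dense_normP (R : realType) (X : normedModType R[i]) (S : set X) :
  dense S <->
  forall (x : X) (r : R), 0 < r -> exists2 y, S y & `|x - y| < r%:C.
Proof.
split=> [dS x r r0|dS O [x Ox] /open_norm_ball /(_ Ox)[r r0 rO]].
  have r0' : 0 < r%:C :> R[i] by rewrite ltcR.
  have [|y [xy Sy]] := dS (ball x r%:C) _ (ball_open _ _).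
    by exists x; exact: ballxx.
  by exists y => //; rewrite -ball_normE in xy.
by have [y Sy xy] := dS x r r0; exists y; split => //; exact: rO.
Qed.

(** * Geometric series and a criterion for finite dimension *)

Lemma geometric_dominated_cvg (R : realType) (a : nat -> R) (M : R) :
  0 <= M -> (forall k, `|a k| <= M * 2^-1 ^+ k) -> cvgn (series a).
Proof.
move=> M0 aM; apply: normed_cvg.
apply: (@series_le_cvg _ _ (geometric M 2^-1)) => //.
- by move=> n /=; exact: normr_ge0.
- by move=> n; rewrite /geometric/= mulr_ge0// exprn_ge0.
- by apply: is_cvg_geometric_series; rewrite ger0_norm// invf_lt1// ltr1n.
Qed.

Lemma complex_geometric_dominated_cvg (R : realType) (a : nat -> R[i]) (M : R) :
  0 <= M -> (forall k, `|a k| <= (M * 2^-1 ^+ k)%:C) ->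
  exists l : R[i], forall eps : R, 0 < eps ->
    \forall n \near \oo, `|\sum_(0 <= k < n) a k - l| < eps%:C.
Proof.
move=> M0 aM.
have reM : cvgn (series (fun k => complex.Re (a k))).
  apply: (geometric_dominated_cvg M0) => k; rewrite -lecR.
  exact: le_trans (normc_ge_Re _) (aM k).
have imM : cvgn (series (fun k => complex.Im (a k))).
  (* Up to sign, the imaginary part is the real part of the product with ['i], which has modulus
     1. *)
  apply: (geometric_dominated_cvg M0) => k; rewrite -lecR -normrN -ReiNIm.
  apply: le_trans (normc_ge_Re _) _; rewrite normrM.
  by rewrite (_ : `|'i%C| = 1 :> R[i]) ?mulr1// normc_def/= expr0n add0r expr1n sqrtr1.
set lr := limn (series (fun k => complex.Re (a k))) in reM.
set li := limn (series (fun k => complex.Im (a k))) in imM.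
exists (lr +i* li) => eps eps0; have e2 : 0 < eps / 2 by rewrite divr_gt0.
have /cvgrPdist_lt/(_ _ e2) Hr := reM; have /cvgrPdist_lt/(_ _ e2) Hi := imM.
near=> n; apply: (le_lt_trans (norm_complex_le _)); rewrite ltcR (splitr eps).
have -> : complex.Re (\sum_(0 <= k < n) a k - (lr +i* li)) =
    series (fun k => complex.Re (a k)) n - lr.
  rewrite /series/= -(big_morph (@complex.Re R) (id1 := 0) (op1 := +%R) (id2 := 0) (op2 := +%R))//.
    by case: (\sum_(0 <= k < n) a k).
  by move=> [? ?] [? ?].
have -> : complex.Im (\sum_(0 <= k < n) a k - (lr +i* li)) =
    series (fun k => complex.Im (a k)) n - li.
  rewrite /series/= -(big_morph (@complex.Im R) (id1 := 0) (op1 := +%R) (id2 := 0) (op2 := +%R))//.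
    by case: (\sum_(0 <= k < n) a k).
  by move=> [? ?] [? ?].
by rewrite ltrD// distrC; near: n.
Unshelve. all: end_near. Qed.

(** Each approximation at least halves the norm of the remainder, and the coefficients are bounded
    by the remainder; so they sum geometrically while the remainder tends to 0. *)
Lemma finite_dimensional_approx (R : realType) (X : normedModType R[i])
    (n : nat) (e : 'I_n -> X) (M : R) : 0 <= M ->
  (forall w : X, exists c : 'I_n -> R[i],
    (forall i, `|c i| <= M%:C * `|w|) /\
    `|w - \sum_(i < n) c i *: e i| <= `|w| / 2) ->
  finite_dimensional X.
Proof.
move=> M0 /choice[c cP]; exists n, e => x.
have cM v i : `|c v i| <= M%:C * `|v| by case: (cP v).
have ce v : `|v - \sum_(i < n) c v i *: e i| <= `|v| / 2 by case: (cP v).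
pose w k := iter k (fun w => w - \sum_(i < n) c w i *: e i) x.
have [r r0 xr] : exists2 r : R, 0 <= r & `|x| = r%:C.
  exact: ge0_complexP.
have w_le k : `|w k| <= (r * 2^-1 ^+ k)%:C.
  elim: k => [|k IH]; first by rewrite expr0 mulr1 /= xr.
  apply: (le_trans (ce _)); rewrite -/(w k) exprSr mulrA rmorphM/=.
  by rewrite fmorphV rmorph_nat ler_wpM2r.
have wE m : x = w m + \sum_(i < n) (\sum_(0 <= k < m) c (w k) i) *: e i.
  elim: m => [|m ->] /=.
    by rewrite big1 ?addr0// => i _; rewrite big_nil scale0r.
  rewrite -/(w m) -addrA; congr (_ + _).
  rewrite [X in _ = - _ + X](_ : _ =
    \sum_(i < n) c (w m) i *: e i +
    \sum_(i < n) (\sum_(0 <= k < m) c (w k) i) *: e i) ?addKr//.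
  rewrite -big_split/=; apply: eq_bigr => i _.
  by rewrite big_nat_recr//= scalerDl addrC.
have /choice[l lP] (i : 'I_n) : exists l : R[i], forall eps : R, 0 < eps ->
    \forall m \near \oo, `|\sum_(0 <= k < m) c (w k) i - l| < eps%:C.
  apply: (@complex_geometric_dominated_cvg _ _ (M * r)); first exact: mulr_ge0.
  move=> k; apply: (le_trans (cM _ _)); rewrite -mulrA [leRHS]rmorphM/=.
  by rewrite ler_wpM2l// ler0c.
exists l; apply/eqP; rewrite -subr_eq0 -normr_le0.
have [E E0 EE] : exists2 E : R, 0 <= E & \sum_(i < n) `|e i| = E%:C.
  by apply: ge0_complexP; rewrite sumr_ge0.
set d := `|_|; have [D D0 dD] : exists2 D : R, 0 <= D & d = D%:C.
  by apply: ge0_complexP; rewrite normr_ge0.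
rewrite dD lecR; apply/ler_addgt0Pr => eps eps0; rewrite add0r.
have e2 : 0 < eps / 2 by rewrite divr_gt0.
(* Half of [eps] bounds the remainder, half the coefficient errors weighted by the norms of the
   [e i]; [E + 1] is positive even if [E] is 0. *)
have eE : 0 < eps / 2 / (E + 1) by rewrite divr_gt0// ltr_wpDl.
have wcvg : r * 2^-1 ^+ m @[m --> \oo] --> 0.
  rewrite -(mulr0 r); apply: cvgMl_tmp; apply: cvg_expr.
  by rewrite ger0_norm// invf_lt1// ltr1n.
have /cvgrPdist_lt/(_ _ e2) Hw := wcvg.
have Hl : \forall m \near \oo, forall i,
    `|\sum_(0 <= k < m) c (w k) i - l i| < (eps / 2 / (E + 1))%:C.
  by apply: filter_forall => i; exact: lP.
near \oo => m; rewrite -lecR -dD /d {1}(wE m) -addrA -sumrB.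
apply: (le_trans (ler_normD _ _)); rewrite (splitr eps) rmorphD/= lerD//.
  apply: (le_trans (w_le m)); rewrite lecR ltW//.
  have : `|0 - r * 2^-1 ^+ m| < eps / 2 by near: m.
  by rewrite sub0r normrN ger0_norm// mulr_ge0// exprn_ge0.
apply: (le_trans (ler_norm_sum _ _ _)).
apply: (@le_trans _ _ (\sum_(i < n) (eps / 2 / (E + 1))%:C * `|e i|)).
  apply: ler_sum => i _; rewrite -scalerBl normrZ ler_wpM2r// ltW//.
  by move: i; near: m.
rewrite -mulr_sumr EE -rmorphM/= lecR mulrAC ler_pdivrMr ?ltr_wpDl//.
by rewrite ler_pM2l// lerDl.
Unshelve. all: end_near. Qed.

(** * Density of the tails of a dense disk orbit *)

(** The orbit segment is the continuous image of a compact interval; the [e i] are the centres of a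
    finite subcover by balls. *)
Lemma orbit_segment_precompact (R : realType) (X : normedModType R[i])
    (T : R -> {linear X -> X}) (x : X) (L d : R) :
  C0_semigroup T -> 0 < d ->
  exists (n : nat) (e : 'I_n -> X),
    forall t, 0 <= t <= L -> exists i, `|T t x - e i| < d%:C.
Proof.
move=> TC d0; have d0' : 0 < d%:C :> R[i] by rewrite ltcR.
have cT : {within `[0, L]%classic, continuous (fun t => T t x)}.
  apply/subspace_continuousP => s; rewrite /= in_itv/= => /andP[s0 _].
  move=> A xA.
  have nA : nbhs s [set t : R | 0 <= t -> A (T t x)].
    exact: (C0_semigroup_cvg TC s0 xA).
  have : nbhs s [set t : R | `[0, L]%classic t -> A (T t x)].
    apply: filterS nA => t /= tA; rewrite in_itv/= => /andP[t0 _]; exact: tA.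
  by [].
have := continuous_compact cT (segment_compact (a := 0) (b := L)).
rewrite compact_cover => /(_ X setT (fun y => ball y d%:C)).
case=> [y _|y _|D _ DT].
- exact: ball_open.
- by exists y => //; exact: ballxx.
exists (size (finmap.enum_fset D)), (fun i => nth 0 (finmap.enum_fset D) i) => t tL.
have [|y /= yD] := DT (T t x); first by exists t; rewrite //= in_itv.
rewrite -ball_normE/= distrC => yT.
have iD : (index y (finmap.enum_fset D) < size (finmap.enum_fset D))%N by rewrite index_mem.
by exists (Ordinal iD); rewrite /= nth_index.
Qed.

Lemma dense_disk_orbit_tail (R : realType) (X : normedModType R[i])
    (T : R -> {linear X -> X}) (x : X) (L : R) :
  infinite_dimensional X -> C0_semigroup T -> dense (disk_orbit T x) ->
  dense [set y | exists (alpha : R[i]) (t : R),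
    [/\ unit_disk alpha, L < t & y = alpha *: T t x]].
Proof.
move=> Xinf TC /dense_normP dT; apply/dense_normP => u r r0.
apply: contrapT => tail_far; apply: Xinf.
(* Orbit points within [d] of the [k]-ball around [u] stay within [r] of [u], as [k + d < r], so
   they have [t <= L]. Four errors of size [d] will add up to [k / 2]. *)
pose k := r / 4; pose d := k / 8.
have k0 : 0 < k by rewrite divr_gt0.
have d0 : 0 < d by rewrite divr_gt0.
have [n [e eP]] := orbit_segment_precompact x L TC d0.
have near_e p : `|u - p| <= k%:C ->
    exists (alpha : R[i]) i, unit_disk alpha /\ `|p - alpha *: e i| <= (2 * d)%:C.
  move=> up; have [y [alpha [t [alpha1 t0 ->]]] py] := dT p d d0.
  have [tL|Lt] := leP t L; last first.
    exfalso; apply: tail_far; exists (alpha *: T t x).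
      by exists alpha, t.
    rewrite -(subrKA p) (le_lt_trans (ler_normD _ _))//.
    apply: (le_lt_trans (lerD up (ltW py))).
    rewrite -rmorphD/= ltcR /d /k; lra.
  have [i ti] := eP t (introT andP (conj t0 tL)).
  exists alpha, i; split=> //; rewrite -(subrKA (alpha *: T t x)).
  apply: (le_trans (ler_normD _ _)); rewrite mulr_natl mulr2n rmorphD/=.
  apply: lerD; first exact: ltW.
  rewrite -scalerBr normrZ (le_trans _ (ltW ti))// ler_piMl//.
apply: (@finite_dimensional_approx _ _ n e (2 / k)).
  by rewrite divr_ge0// ltW.
move=> w; have [->|w0] := eqVneq w 0.
  exists (fun=> 0); split=> [i|]; first by rewrite !normr0 mulr0.
  by rewrite big1 ?subr0 ?normr0 ?mul0r// => i _; rewrite scale0r.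
have [s s0 ws] : exists2 s : R, 0 < s & `|w| = s%:C.
  by apply: gt0_complexP; rewrite normr_gt0.
have ks0 : 0 < k / s by rewrite divr_gt0.
have [|a0 [i0 [a01 ea0]]] := near_e u.
  by rewrite subrr normr0 ler0c ltW.
have [|a1 [i1 [a11 ea1]]] := near_e (u + (k / s)%:C *: w).
  rewrite opprD addNKr normrN normrZ normR_complex ws -rmorphM/= lecR.
  by rewrite gtr0_norm// divfK// gt_eqF.
(* [(k / s) w] is the difference of two points of the [k]-ball around [u], hence within
   [4 d = k / 2] of [a1 e_i1 - a0 e_i0]; scaling by [s / k] makes the error [s / 2]. The formula
   also covers [i0 = i1]. *)
exists (fun j => (s / k)%:C * (a1 *+ (j == i1) - a0 *+ (j == i0))).
have sk0 : 0 <= (s / k)%:C :> R[i] by rewrite ler0c divr_ge0 ?ltW.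
have kV : (s / k)%:C * (k / s)%:C = 1 :> R[i].
  rewrite -rmorphM/= mulrA divfK ?gt_eqF// divff ?gt_eqF//.
split=> [j|].
  rewrite ws normrM normR_complex (gtr0_norm (divr_gt0 s0 k0)).
  rewrite (_ : (2 / k)%:C * s%:C = (s / k)%:C * 2%:C); last first.
    by rewrite -!rmorphM/= mulrC mulrA mulrAC.
    rewrite (ler_wpM2l sk0)// (le_trans (ler_normB _ _))//.
  rewrite rmorph_nat [leRHS](_ : _ = 1 + 1)// lerD//.
    by case: (j == i1); rewrite ?mulr1n ?mulr0n ?normr0.
  by case: (j == i0); rewrite ?mulr1n ?mulr0n ?normr0.
have delta_sum (a : R[i]) i : \sum_(j < n) (a *+ (j == i)) *: e j = a *: e i.
  rewrite (bigD1 i)//= eqxx big1 ?addr0// => j /negPf ->.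
  by rewrite mulr0n scale0r.
under eq_bigr do rewrite -scalerA scalerBl.
rewrite -scaler_sumr sumrB !delta_sum.
rewrite {1}(_ : w = ((s / k)%:C * (k / s)%:C) *: w); last by rewrite kV scale1r.
rewrite -scalerA -scalerBr normrZ normR_complex.
rewrite (gtr0_norm (divr_gt0 s0 k0)) ws.
rewrite [X in _ * `|X|](_ : _ = (u + (k / s)%:C *: w - a1 *: e i1) - (u - a0 *: e i0)); last first.
  rewrite !opprB [u + _]addrC -!addrA; congr (_ + _).
  by rewrite [RHS]addrC [X in _ = X + u]addrA subrK addrC.
apply: (@le_trans _ _ ((s / k)%:C * ((2 * d)%:C + (2 * d)%:C))).
  rewrite (ler_wpM2l sk0)// (le_trans (ler_normB _ _))//.
  exact: lerD.
rewrite (_ : s%:C / 2 = (s / 2)%:C); last by rewrite rmorphM fmorphV rmorph_nat.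
rewrite -rmorphD -rmorphM/= lecR /d.
rewrite (_ : s / k * (2 * (k / 8) + 2 * (k / 8)) = s / 2)//.
by field; rewrite gt_eqF.
Qed.

(** * Baire's theorem over the complex numbers *)

(* The library's [Baire] requires the scalars to form a [realType], which
   excludes R[i]. *)
Lemma complex_Baire (R : realType) (X : completeNormedModType R[i])
    (F : nat -> set X) :
  (forall n, open (F n)) -> (forall n, dense (F n)) -> dense (\bigcap_n F n).
Proof.
move=> Fo Fd; apply/dense_normP => x r r0.
(* One step of the nested balls: a closed ball inside both [F n] and the previous open ball.
   Guarding by a positive radius makes the step a total function. *)
have /choice[step stepP] (q : nat * (X * R)) : exists q' : X * R, 0 < q.2.2 ->
    [/\ 0 < q'.2, q'.2 <= q.1.+1%:R^-1 & forall y, `|q'.1 - y| <= q'.2%:C ->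
        F q.1 y /\ `|q.2.1 - y| < q.2.2%:C].
  case: q => n [a d] /=.
  have [d0|_] := ltP 0 d; last by exists (a, d).
  have d2 : 0 < d / 2 by rewrite divr_gt0.
  have [b Fb ab] := (dense_normP _).1 (Fd n) a _ d2.
  have [s s0 sF] := open_norm_ball (Fo n) Fb.
  exists (b, Num.min (Num.min (d / 2) (s / 2)) n.+1%:R^-1) => _ /=.
  split=> [||y by_].
  - by rewrite !lt_min d2 divr_gt0//= invr_gt0.
  - by rewrite ge_min lexx orbT.
  split.
    apply: sF; apply: (le_lt_trans by_); rewrite ltcR !gt_min.
    by rewrite (_ : s / 2 < s) ?orbT//; lra.
  rewrite -(subrKA b) (le_lt_trans (ler_normD _ _))//.
  rewrite (splitr d) rmorphD/= ltr_leD// (le_trans by_)// lecR.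
  by rewrite !ge_min lexx.
pose p := fix p n := if n is m.+1 then step (m, p m) else (x, r).
have p0 n : 0 < (p n).2 by elim: n => //= n IH; have [] := stepP (n, p n) IH.
have pS n y : `|(p n.+1).1 - y| <= (p n.+1).2%:C ->
    F n y /\ `|(p n).1 - y| < (p n).2%:C.
  by have [_ _] := stepP (n, p n) (p0 n); exact.
have p_anti n m : `|(p n).1 - (p (m + n)%N).1| <= (p n).2%:C.
  have anti k y : `|(p (k + n)%N).1 - y| <= (p (k + n)%N).2%:C ->
      `|(p n).1 - y| <= (p n).2%:C.
    elim: k => // k IH; rewrite addSn => /pS[_ /ltW]; exact: IH.
  by apply: (anti m); rewrite subrr normr0 ler0c ltW.
have /cauchy_cvg pcvg : cauchy ((fst \o p) n @[n --> \oo]).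
  apply: cauchy_exP => _ /gt0_complexP[e e0 ->].
  have [m me] := ltr_add_invr e0; rewrite add0r in me.
  exists (p m.+1).1; exists m.+1 => // n /= mn; rewrite -ball_normE/=.
  have := p_anti m.+1 (n - m.+1)%N; rewrite subnK// => pmn.
  apply: (le_lt_trans pmn); rewrite ltcR (le_lt_trans _ me)//.
  by have [_] := stepP (m, p m) (p0 m).
set l := lim _ in pcvg.
(* Later centres all lie in the [n]-th closed ball, hence so does their limit. *)
have pl n : `|(p n).1 - l| <= (p n).2%:C.
  have [D D0 DE] : exists2 D : R, 0 <= D & `|(p n).1 - l| = D%:C.
    exact: ge0_complexP.
  rewrite DE lecR; apply/ler_addgt0Pr => eps eps0; rewrite -lecR -DE.
  have eps0' : 0 < eps%:C :> R[i] by rewrite ltcR.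
  have /cvgrPdist_lt/(_ _ eps0')[N _ Nl] := pcvg.
  rewrite -(subrKA (p (N + n)%N).1) (le_trans (ler_normD _ _))// rmorphD/= lerD//.
  by rewrite distrC ltW//; apply: Nl; rewrite /= leq_addr.
exists l; last by have [] := pS 0%N l (pl 1%N).
by move=> n _; have [] := pS n l (pl n.+1).
Qed.

(** * Diskcyclicity and the approximation conditions *)

Lemma transitive_diskcyclic (R : realType) (X : completeNormedModType R[i])
    (T : R -> {linear X -> X}) :
  separable_space X -> C0_semigroup T ->
  (forall (y z : X) (eps : R), 0 < eps ->
     exists (v : X) (t : R) (alpha : R[i]),
       [/\ 0 < t, unit_disk alpha, `|y - v| < eps%:C
         & `|z - alpha *: T t v| < eps%:C]) ->
  diskcyclic T.
Proof.
move=> [D Dc Dd] TC trans.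
have [d0 Dd0] : D !=set0.
  by have [|d [_ Dd0]] := Dd setT _ openT; [exists 0 | exists d].
have [z Dz] : exists z : nat -> X, D `<=` range z.
  have /pfcard_geP[D0|/unsquash z] := Dc; first by rewrite D0 in Dd0.
  by exists z => d /(@surj _ _ _ _ z)[n _ <-]; exists n.
pose F nm := \bigcup_(q in [set q : R[i] * R | unit_disk q.1 /\ 0 < q.2])
  ((fun v => q.1 *: T q.2 v) @^-1` ball (z nm.1) (nm.2.+1%:R^-1)%:C).
have Fo nm : open (F nm).
  apply: bigcup_open => -[alpha t] /= [_ t0]; apply: open_comp (ball_open _ _).
  move=> v _; apply: continuous_comp; last exact: scaler_continuous.
  exact: (C0_semigroup_operator TC (ltW t0)).
have Fd nm : dense (F nm).
  apply/dense_normP => y r r0.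
  have e0 : 0 < Num.min r nm.2.+1%:R^-1 by rewrite lt_min r0 invr_gt0/= ltr0n.
  have [v [t [alpha [t0 alpha1 yv zv]]]] := trans y (z nm.1) _ e0.
  exists v; last by rewrite (lt_le_trans yv)// lecR ge_min lexx.
  exists (alpha, t) => //=; rewrite -ball_normE/= (lt_le_trans zv)//.
  by rewrite lecR ge_min lexx orbT.
(* The pairs [(n, m)] are enumerated by [unpickle], with default [(0, 0)] for numbers that code no
   pair. Density at 0 with radius 1 merely yields a point of the intersection. *)
have [|x Fx _] := (dense_normP _).1 (complex_Baire (F := fun n =>
  F (odflt (0, 0) (unpickle n))%N) (fun=> Fo _) (fun=> Fd _)) 0 1.
  exact: ltr01.
exists x; apply/dense_normP => y r r0; have r2 : 0 < r / 2 by rewrite divr_gt0.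
have [d /Dz[n _ <-] yn] := (dense_normP _).1 Dd y _ r2.
have [m mr] := ltr_add_invr r2; rewrite add0r in mr.
have := Fx (pickle (n, m)) I; rewrite pickleK /= => -[[alpha t] /= [alpha1 t0]].
rewrite -ball_normE/= => nx; exists (alpha *: T t x).
  by exists alpha, t; split => //; exact: ltW.
rewrite -(subrKA (z n)) (le_lt_trans (ler_normD _ _))// (splitr r) rmorphD/=.
by rewrite ltrD// (lt_trans nx)// ltcR.
Qed.

Lemma diskcyclic_transitive (R : realType) (X : normedModType R[i])
    (T : R -> {linear X -> X}) (y z : X) (eps l : R) :
  infinite_dimensional X -> C0_semigroup T -> diskcyclic T ->
  0 < eps -> 0 <= l ->
  exists (v : X) (t : R) (alpha : R[i]),
    [/\ l < t, unit_disk alpha, `|y - v| < eps%:C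
      & `|z - alpha *: T t v| < eps%:C].
Proof.
move=> Xinf TC [x xd] eps0 l0.
have [v0 [a [s [a1 s0 v0E]]] [v0n0 yv]] : exists2 v, disk_orbit T x v &
    v != 0 /\ `|y - v| < eps%:C.
  (* A zero space would be spanned by the empty family. *)
  have [w w0] : exists w : X, w != 0.
    apply: contrapT => X0; apply: Xinf; exists 0%N, (fun=> 0) => w.
    exists (fun=> 0); rewrite big_ord0; apply/eqP/negPn/negP => w0.
    by apply: X0; exists w.
  have e2 : 0 < eps / 2 by rewrite divr_gt0.
  (* If [y = 0], a vector of norm [eps / 3] replaces it; an orbit point closer to [y'] than the norm
     of [y'] is then nonzero. *)
  have [y' [y'0 yy']] : exists y', y' != 0 /\ `|y - y'| < (eps / 2)%:C.
    have [y0|] := eqVneq y 0; last by exists y; rewrite subrr normr0 ltcR.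
    exists ((eps / 3)%:C / `|w| *: w); split.
      rewrite scaler_eq0 negb_or w0 andbT mulf_neq0 ?invr_eq0 ?normr_eq0//.
      by rewrite (inj_eq (@complexI _)) gt_eqF// divr_gt0.
    rewrite y0 sub0r normrN normrZ normrM normfV normr_id divfK ?normr_eq0//.
    by rewrite normR_complex ltcR gtr0_norm ?divr_gt0//; lra.
  have [d d0 yd] : exists2 d : R, 0 < d & `|y'| = d%:C.
    by apply: gt0_complexP; rewrite normr_gt0.
  have m0 : 0 < Num.min d (eps / 2) by rewrite lt_min d0.
  have [v vx yv] := (dense_normP _).1 xd y' _ m0.
  exists v => //; split.
    apply: contraTneq yv => ->.
    by rewrite subr0 yd ltcR lt_min ltxx.
  rewrite -(subrKA y') (le_lt_trans (ler_normD _ _))// (splitr eps) rmorphD/=.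
  by rewrite ltrD// (lt_le_trans yv)// lecR ge_min lexx orbT.
have an0 : a != 0.
  by apply: contraNneq v0n0 => a0; rewrite v0E a0 scale0r.
have [d d0 ad] : exists2 d : R, 0 < d & `|a| = d%:C.
  by apply: gt0_complexP; rewrite normr_gt0.
(* Since [T (r - s) v0 = a *: T r x], the target is [z] divided by [a] and the tolerance [eps]
   divided by the modulus [d] of [a]; [r > s + l] gives [r - s > l]. *)
have [|_ [b [r [b1 sr ->]]] zb] := (dense_normP _).1
  (dense_disk_orbit_tail (s + l) Xinf TC xd) (a^-1 *: z) (eps / d).
  by rewrite divr_gt0.
exists v0, (r - s), b; split=> //; first by rewrite ltrBrDl.
have -> : T (r - s) v0 = a *: T r x.
  have rs : 0 <= r - s by rewrite subr_ge0 ltW// (le_lt_trans _ sr)// lerDl.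
  by rewrite v0E linearZ/= -(C0_semigroupD TC)// subrK.
have -> : z - b *: (a *: T r x) = a *: (a^-1 *: z - b *: T r x).
  by rewrite scalerBr !scalerA divff// scale1r mulrC.
rewrite normrZ ad -ltr_pdivlMl ?ltcR// mulrC.
by move: zb; rewrite rmorphM/= fmorphV.
Qed.

Theorem theorem4p5 (R : realType) (X : completeNormedModType R[i])
    (X_separable : separable_space X) (X_infinite : infinite_dimensional X)
    (T : R -> {linear X -> X}) (T_semigroup : C0_semigroup T) :
  [<-> diskcyclic T;
       forall (y z : X) (eps : R), 0 < eps ->
         exists (v : X) (t : R) (alpha : R[i]),
           [/\ 0 < t, unit_disk alpha, `|y - v| < eps%:C
             & `|z - alpha *: T t v| < eps%:C];
       forall (y z : X) (eps : R) (l : R), 0 < eps -> 0 <= l ->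
         exists (v : X) (t : R) (alpha : R[i]),
           [/\ l < t, unit_disk alpha, `|y - v| < eps%:C
             & `|z - alpha *: T t v| < eps%:C]].
Proof.
tfae.
- by move=> Tx y z eps eps0; exact: diskcyclic_transitive.
(* Arbitrarily large times are obtained by passing through diskcyclicity. *)
- move=> /(transitive_diskcyclic X_separable T_semigroup) Tx y z eps l eps0 l0.
  exact: diskcyclic_transitive.
- move=> trans; apply: transitive_diskcyclic => // y z eps eps0.
  exact: trans.
Qed.
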